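(* Let $\mathcal{F}=(C_1,\ldots,C_n)$ be an ordered family of pairwise disjoint compact convex sets in $\mathbb{R}^2$. For each $i$ let $f_{C_i}:\mathcal{C}(\mathbb{R}^2)\to\mathbb{R}$ be a monotone function, continuous with respect to the Hausdorff metric, and let $\alpha_{C_i}>0$; write $f=(f_{C_1},\ldots,f_{C_n})$ and $\alpha=(\alpha_{C_1},\ldots,\alpha_{C_n})$. Suppose that for every three indices $i<j<k$ there is a directed line which is an $(f,\alpha)$-transversal of $C_i,C_j,C_k$ and meets them in the order $C_i,C_j,C_k$ along its direction. Then there exists a directed line which is an $(f,\alpha)$-transversal of all of $C_1,\ldots,C_n$.
   Context: $\mathcal{C}(\mathbb{R}^2)$ denotes the family of convex subsets of $\mathbb{R}^2$. A function $g:\mathcal{C}(\mathbb{R}^2)\to\mathbb{R}$ is monotone if for all convex $K_1\subset K_2$ one has $g(K_1)\le g(K_2)$ (or, for a decreasing monotone function, always $g(K_1)\ge g(K_2)$). For a directed line $\ell$ and a convex set $C$, $\ell^+(C)$ is the intersection of $C$ with the closed half-plane bounded by $\ell$ lying to the left of the direction of $\ell$, and $\ell^-(C)$ is the intersection of $C$ with the opposite closed half-plane. A directed line $\ell$ is an $(f,\alpha)$-stabber of $C_i$ if $f_{C_i}(\ell^+(C_i))\ge\alpha_{C_i}$ and $f_{C_i}(\ell^-(C_i))\ge\alpha_{C_i}$; it is an $(f,\alpha)$-transversal of a subfamily if it is an $(f,\alpha)$-stabber of each set in the subfamily.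
   Formalization: The family is assumed to have n ≥ 3 sets, since for n = 1 or 2 the condition on triples is vacuous and the claim can fail (e.g. n = 1, f constantly 0, α = 1). *)

(* Defs.v *)
From HB Require Import structures.
From mathcomp Require Import all_boot all_order all_algebra.
From mathcomp Require Import all_classical all_reals all_analysis.

Set Implicit Arguments.
Unset Strict Implicit.
Unset Printing Implicit Defensive.

Import Order.TTheory GRing.Theory Num.Theory.
Import numFieldNormedType.Exports.

Local Open Scope classical_set_scope.
Local Open Scope ring_scope.

Notation plane R := (R * R)%type (only parsing).

Definition convex_subset (R : realType) (K : set (plane R)) : Prop :=
  @convex_set R (plane R) K.

(* The norm of the library on R * R is the max norm, so the Euclidean distance
   is written out.  The product topology used by compact is the usual one. *)
Definition edist2 (R : realType) (x y : plane R) : R :=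
  Num.sqrt ((x.1 - y.1) ^+ 2 + (x.2 - y.2) ^+ 2).

Definition thickening (R : realType) (e : R) (A : set (plane R)) :
    set (plane R) :=
  [set x | exists2 a, A a & edist2 x a <= e].

(* Extended-real valued, since it is applied to arbitrary convex sets: it is
   +oo when exactly one of the sets is empty, and may be +oo when one of them
   is unbounded.  On nonempty compact sets it is the Hausdorff metric. *)
Definition hausdorff_dist (R : realType) (A B : set (plane R)) : \bar R :=
  ereal_inf [set e%:E | e in
    [set e : R | [/\ 0 <= e, A `<=` thickening e B & B `<=` thickening e A]]].

(* A function on the family of convex sets is represented by a function on all
   subsets of the plane; only its values at convex sets are ever used. *)
Definition monotone_on_convex (R : realType) (g : set (plane R) -> R) : Prop :=
  (forall K1 K2, convex_subset K1 -> convex_subset K2 -> K1 `<=` K2 ->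
     g K1 <= g K2) \/
  (forall K1 K2, convex_subset K1 -> convex_subset K2 -> K1 `<=` K2 ->
     g K2 <= g K1).

Definition hausdorff_continuous (R : realType) (g : set (plane R) -> R) :
    Prop :=
  forall K, convex_subset K -> forall e : R, 0 < e ->
    exists2 d : R, 0 < d &
      forall K', convex_subset K' -> (hausdorff_dist K K' < d%:E)%E ->
        `|g K - g K'| < e.

Record dline (R : realType) := DLine {
  dl_base : plane R;
  dl_dir : plane R;
  dl_dir_neq0 : dl_dir <> (0, 0)
}.

Definition dline_pt (R : realType) (l : dline R) (t : R) : plane R :=
  ((dl_base l).1 + t * (dl_dir l).1, (dl_base l).2 + t * (dl_dir l).2).

(* det (dl_dir l, x - dl_base l): positive iff x is strictly to the left of l. *)
Definition side (R : realType) (l : dline R) (x : plane R) : R :=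
  (dl_dir l).1 * (x.2 - (dl_base l).2) - (dl_dir l).2 * (x.1 - (dl_base l).1).

Definition lplus (R : realType) (l : dline R) (C : set (plane R)) :
    set (plane R) :=
  C `&` [set x | 0 <= side l x].

Definition lminus (R : realType) (l : dline R) (C : set (plane R)) :
    set (plane R) :=
  C `&` [set x | side l x <= 0].

Definition fa_stabber (R : realType) (g : set (plane R) -> R) (a : R)
    (C : set (plane R)) (l : dline R) : Prop :=
  a <= g (lplus l C) /\ a <= g (lminus l C).

Definition fa_transversal (R : realType) (n : nat) (C : 'I_n -> set (plane R))
    (f : 'I_n -> set (plane R) -> R) (alpha : 'I_n -> R)
    (J : set 'I_n) (l : dline R) : Prop :=
  forall i, J i -> fa_stabber (f i) (alpha i) (C i) l.

Definition meets (R : realType) (l : dline R) (A : set (plane R)) : Prop :=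
  exists t, A (dline_pt l t).

Definition precedes (R : realType) (l : dline R) (A B : set (plane R)) : Prop :=
  forall s t, A (dline_pt l s) -> B (dline_pt l t) -> s < t.

Definition meets_in_order (R : realType) (l : dline R)
    (A B D : set (plane R)) : Prop :=
  [/\ meets l A, meets l B, meets l D, precedes l A B & precedes l B D].

(* Main.v *)
Require Import Defs.
From HB Require Import structures.
From mathcomp Require Import all_boot all_order all_algebra.
From mathcomp Require Import all_classical all_reals all_analysis.
From mathcomp Require Import ring lra.

Set Implicit Arguments.
Unset Strict Implicit.
Unset Printing Implicit Defensive.

Import Order.TTheory GRing.Theory Num.Theory.
Import numFieldNormedType.Exports.

Local Open Scope classical_set_scope.
Local Open Scope ring_scope.

(** Fix one transversal for each triple.  A directed line [l] fails [i] on the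
    right (left) if every chosen transversal through [C i] meets [C i] strictly
    to the right (left) of [l].  If [i < j], [l] fails [i] on the right and [j]
    on the left, then every chosen transversal through both crosses [l] from
    right to left; call such a pair of failures positive, and the mirror
    situation negative.  The case [i = j] is given the sign in which the chosen
    transversals through [C i] cross [l].  Comparing crossing directions on
    a common triple shows that both signs cannot occur for the same direction
    of [l].  If every line failed some [i], every direction would have a sign;
    the sign is locally constant but is reversed by turning the direction by
    [pi], which is absurd.  So some [l] fails no [i], and monotonicity makes such
    an [l] a stabber of every [C i]. *)

(** * Connectedness of the real line and heights over a direction *)

Lemma open_cover_real_meet (R : realType) (U V : set R) :
  open U -> open V -> U !=set0 -> V !=set0 -> (forall x, U x \/ V x) ->
  exists x, U x /\ V x.
Proof.
move=> oU oV U0 [v Vv] UV; apply: contrapT => /forallNP UVN.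
have : connected [set: R] by apply/connected_intervalP => x y _ _ z _.
move=> /(_ U U0) H.
have UT : U = setT.
  apply: H; first by exists U => //; rewrite setTI.
  exists (~` V); first exact: open_closedC.
  rewrite setTI; apply/seteqP; split => x; first by move=> Ux Vx; case: (UVN x).
  by case: (UV x).
by case: (UVN v); rewrite UT.
Qed.

(** The signed distance of [x] from the line through the origin with direction [(cos th, sin th)].
    On a direction vector it is a cross product, positive iff the vector crosses lines of this
    direction from right to left. *)
Definition height (R : realType) (th : R) (x : plane R) : R :=
  cos th * x.2 - sin th * x.1.

Lemma heightDpi (R : realType) (th : R) x : height (th + pi) x = - height th x.
Proof. by rewrite /height cosDpi sinDpi !mulNr opprB opprK addrC. Qed.

Lemma continuous_height (R : realType) (x : plane R) :
  continuous (fun th => height th x).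
Proof.
move=> th; rewrite /height; apply: cvgB.
- by apply: cvgM; [exact: continuous_cos | exact: cvg_cst].
- by apply: cvgM; [exact: continuous_sin | exact: cvg_cst].
Qed.

(** * Signs of directions for an abstract family of ordered transversals *)

Section ordered_lines.
(** [T] indexes the chosen transversals, with base points [a] and directions [u]; [mem i tau] says
    that [tau] was chosen through the [i]-th set, and [S i tau] stands for the parameters where it
    meets that set. *)
Context (R : realType) (n : nat) (T : finType) (mem : 'I_n -> T -> bool).
Context (a u : T -> plane R) (S : 'I_n -> T -> set R).
Hypothesis n_gt0 : (0 < n)%N.
Hypothesis mem3 : forall i j k, exists tau, [/\ mem i tau, mem j tau & mem k tau].
Hypothesis S_neq0 : forall i tau, mem i tau -> S i tau !=set0.
Hypothesis S_order : forall i j tau, mem i tau -> mem j tau -> (i < j)%N ->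
  forall s t, S i tau s -> S j tau t -> s < t.

(* In what follows [th] is the direction of a line and [s] its signed offset: a
   point [x] is to the left of the line iff [s < height th x]. *)
Definition lheight (th : R) tau t := height th (a tau) + t * height th (u tau).

(** One strict witness for each of finitely many transversals makes this open in [th] and in [s];
    its negation gives a transversal with all of [S i tau] on the closed left side. *)
Definition right_of i (th s : R) :=
  forall tau, mem i tau -> exists2 t, S i tau t & lheight th tau t < s.
Definition left_of i (th s : R) :=
  forall tau, mem i tau -> exists2 t, S i tau t & s < lheight th tau t.

Definition all_up i th := exists2 j, j <> i &
  forall tau, mem i tau -> mem j tau -> 0 < height th (u tau).
Definition all_down i th := exists2 j, j <> i &
  forall tau, mem i tau -> mem j tau -> height th (u tau) < 0.

(* When [i] fails on both sides, no transversal through [i] is parallel to the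
   line.  A second failing index [j] makes all of those through [i] and [j] cross
   it in the same direction, which must then be the sign chosen for [i]; if no
   [j] could do so, the sign is read off an arbitrary transversal [tau0 i]. *)
Definition tau0 i := sval (cid (mem3 i i i)).
Definition upward i th :=
  all_up i th \/ ~ all_down i th /\ 0 < height th (u (tau0 i)).

Definition positive_pair th (i j : 'I_n) := (i < j)%N \/ i = j /\ upward i th.

Lemma mem_tau0 i : mem i (tau0 i).
Proof. by rewrite /tau0; case: cid => ? /= []. Qed.

Lemma lheightDpi th tau t : lheight (th + pi) tau t = - lheight th tau t.
Proof. by rewrite /lheight !heightDpi; lra. Qed.

Lemma continuous_lheight tau t : continuous (fun th => lheight th tau t).
Proof.
move=> th; rewrite /lheight; apply: cvgD; first exact: continuous_height.
by apply: cvgM; [exact: cvg_cst | exact: continuous_height].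
Qed.

Lemma right_ofW i th s s' : s <= s' -> right_of i th s -> right_of i th s'.
Proof.
by move=> ss' r tau /r[t St lt]; exists t => //; exact: lt_le_trans ss'.
Qed.

Lemma left_ofW i th s s' : s' <= s -> left_of i th s -> left_of i th s'.
Proof.
by move=> ss' r tau /r[t St lt]; exists t => //; exact: le_lt_trans lt.
Qed.

(** Direction [th + pi] with offset [- s] is the same line reversed, so its sides are exchanged. *)
Lemma right_ofDpi i th s : right_of i (th + pi) (- s) <-> left_of i th s.
Proof.
split=> r tau /r[t St lt]; exists t => //; move: lt; rewrite lheightDpi; lra.
Qed.

Lemma left_ofDpi i th s : left_of i (th + pi) (- s) <-> right_of i th s.
Proof.
split=> r tau /r[t St lt]; exists t => //; move: lt; rewrite lheightDpi; lra.
Qed.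

Lemma right_of_near i th s : right_of i th s ->
  \forall th' \near th, right_of i th' s.
Proof.
move=> r; apply: (@filter_forall R T _ (nbhs th)) => tau.
case: (boolP (mem i tau)) => [mi|_]; last exact: nearW.
have [t St lt] := r _ mi.
near=> th' => _; exists t => //; near: th'.
exact: cvgr_lt _ (@continuous_lheight tau t th) _ lt.
Unshelve. all: by end_near. Qed.

Lemma left_of_near i th s : left_of i th s ->
  \forall th' \near th, left_of i th' s.
Proof.
move=> r; apply: (@filter_forall R T _ (nbhs th)) => tau.
case: (boolP (mem i tau)) => [mi|_]; last exact: nearW.
have [t St lt] := r _ mi.
near=> th' => _; exists t => //; near: th'.
exact: cvgr_gt _ (@continuous_lheight tau t th) _ lt.
Unshelve. all: by end_near. Qed.

Lemma right_of_near_offset i th s : right_of i th s ->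
  \forall s' \near s, right_of i th s'.
Proof.
move=> r; apply: (@filter_forall R T _ (nbhs s)) => tau.
case: (boolP (mem i tau)) => [mi|_]; last exact: nearW.
have [t St lt] := r _ mi.
by near=> s' => _; exists t => //; near: s'; exact: lt_nbhsr.
Unshelve. all: by end_near. Qed.

Lemma left_of_near_offset i th s : left_of i th s ->
  \forall s' \near s, left_of i th s'.
Proof.
move=> r; apply: (@filter_forall R T _ (nbhs s)) => tau.
case: (boolP (mem i tau)) => [mi|_]; last exact: nearW.
have [t St lt] := r _ mi.
by near=> s' => _; exists t => //; near: s'; exact: lt_nbhsl.
Unshelve. all: by end_near. Qed.

Lemma right_of_ex i th : exists s, right_of i th s.
Proof.
suff : \forall s \near +oo, right_of i th s.
  by move=> /filter_ex[s]; exists s.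
apply: (@filter_forall R T _ (pinfty_nbhs R)) => tau.
case: (boolP (mem i tau)) => [mi|_]; last exact: nearW.
have [t St] := S_neq0 mi.
by near=> s => _; exists t => //; near: s; apply: nbhs_pinfty_gt; exact: num_real.
Unshelve. all: by end_near. Qed.

Lemma left_of_ex i th : exists s, left_of i th s.
Proof.
have [s r] := right_of_ex i (th + pi); exists (- s).
by apply/right_ofDpi; rewrite opprK.
Qed.

(** The transversal is below height [s] at a parameter for [i] and above it at a later parameter for
    [j], so it rises. *)
Lemma slope_gt0 (i j : 'I_n) tau th s : (i < j)%N -> mem i tau -> mem j tau ->
  right_of i th s -> left_of j th s -> 0 < height th (u tau).
Proof.
move=> ij mi mj /(_ _ mi)[t St lt] /(_ _ mj)[t' St' lt'].
have tt' := S_order mi mj ij St St'.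
have := lt_trans lt lt'; rewrite ltrD2l -subr_gt0 -mulrBl.
by rewrite pmulr_rgt0 // subr_gt0.
Qed.

Lemma slope_lt0 (i j : 'I_n) tau th s : (i < j)%N -> mem i tau -> mem j tau ->
  left_of i th s -> right_of j th s -> height th (u tau) < 0.
Proof.
move=> ij mi mj l r; rewrite -oppr_gt0 -heightDpi.
by apply: (@slope_gt0 i j tau (th + pi) (- s)) => //;
  [exact/right_ofDpi | exact/left_ofDpi].
Qed.

Lemma slope_neq0 i tau th s : mem i tau ->
  right_of i th s -> left_of i th s -> height th (u tau) != 0.
Proof.
move=> mi /(_ _ mi)[t _ lt] /(_ _ mi)[t' _ lt']; apply/eqP => h0.
by move: lt lt'; rewrite /lheight h0; lra.
Qed.

(** A transversal through [i] and both witnesses would have to rise and descend. *)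
Lemma all_upN_all_down i th : all_up i th -> ~ all_down i th.
Proof.
move=> [j _ Hj] [k _ Hk]; have [tau [mi mj mk]] := mem3 i j k.
by have := Hj _ mi mj; have := Hk _ mi mk; lra.
Qed.

Lemma upwardN_all_down i th : upward i th -> ~ all_down i th.
Proof. by move=> [/all_upN_all_down//|[]]. Qed.

Lemma all_upDpi i th : all_up i (th + pi) <-> all_down i th.
Proof.
by split=> -[j ji H]; exists j => // tau mi mj; move: (H _ mi mj);
  rewrite heightDpi ?oppr_gt0 // => ?; rewrite oppr_gt0.
Qed.

Lemma all_downDpi i th : all_down i (th + pi) <-> all_up i th.
Proof.
by split=> -[j ji H]; exists j => // tau mi mj; move: (H _ mi mj);
  rewrite heightDpi ?oppr_lt0 // => ?; rewrite oppr_lt0.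
Qed.

(** The reversal exchanges [all_up] and [all_down], which exclude each other; when neither holds,
    the slope of [tau0 i], nonzero by the two failures, changes sign. *)
Lemma upwardDpi i th s : right_of i th s -> left_of i th s ->
  upward i (th + pi) <-> ~ upward i th.
Proof.
move=> r l; have h0 := slope_neq0 (mem_tau0 i) r l.
rewrite /upward heightDpi oppr_gt0; split.
- case=> [/all_upDpi d /upwardN_all_down//|[nu h]].
  by case=> [/all_downDpi//|[_]]; lra.
- move=> nup; case: (pselect (all_down i th)) => [/all_upDpi|nd]; first by left.
  right; split; first by move=> /all_downDpi ?; apply: nup; left.
  rewrite lt_neqAle h0 /= leNgt; apply/negP => h.
  by apply: nup; right.
Qed.

(** [upward] depends only on the signs of the slopes of the transversals through [i], and all of
    these slopes are nonzero. *)
Lemma upward_near i th s : right_of i th s -> left_of i th s ->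
  \forall th' \near th, upward i th' <-> upward i th.
Proof.
move=> r l.
have H : \forall th' \near th, forall tau, mem i tau ->
    (0 < height th' (u tau)) = (0 < height th (u tau)) /\
    (height th' (u tau) < 0) = (height th (u tau) < 0).
  apply: (@filter_forall R T _ (nbhs th)) => tau.
  case: (boolP (mem i tau)) => [mi|_]; last exact: nearW.
  have := slope_neq0 mi r l; rewrite neq_lt => /orP[h|h].
  - near=> th' => _.
    have h' : height th' (u tau) < 0.
      by near: th'; exact: cvgr_lt _ (@continuous_height R (u tau) th) _ h.
    by rewrite (lt_gtF h) (lt_gtF h') h h'.
  - near=> th' => _.
    have h' : 0 < height th' (u tau).
      by near: th'; exact: cvgr_gt _ (@continuous_height R (u tau) th) _ h.
    by rewrite (lt_gtF h) (lt_gtF h') h h'.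
near=> th'; have H' : forall tau, mem i tau ->
    (0 < height th' (u tau)) = (0 < height th (u tau)) /\
    (height th' (u tau) < 0) = (height th (u tau) < 0) by near: th'.
have U : all_up i th' <-> all_up i th.
  by split=> -[j ji K]; exists j => // tau mi mj; move: (K _ mi mj);
    have [-> _] := H' _ mi.
have D : all_down i th' <-> all_down i th.
  by split=> -[j ji K]; exists j => // tau mi mj; move: (K _ mi mj);
    have [_ ->] := H' _ mi.
by rewrite /upward U D; have [-> _] := H' _ (mem_tau0 i).
Unshelve. all: by end_near. Qed.

(** As [i] fails on the right and [k] on the left, their order fixes the slope of every transversal
    through both. If [m, k] were negative, this slope would clash with the sign of one of the two
    pairs. *)
Lemma positive_pair_unique th s i j k m :
  right_of i th s -> left_of j th s -> positive_pair th i j ->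
  right_of m th s -> left_of k th s -> positive_pair th m k.
Proof.
move=> ri lj kij rm lk; apply: contrapT => nk.
have uk j' : j' <> k -> (forall tau, mem k tau -> mem j' tau ->
    0 < height th (u tau)) -> upward k th by move=> ? ?; left; exists j'.
have ui : positive_pair th i i -> forall j', j' <> i ->
   (forall tau, mem i tau -> mem j' tau -> height th (u tau) < 0) -> False.
  by case=> [|[_ /upwardN_all_down nd]];
    [rewrite ltnn | move=> j' ? ?; apply: nd; exists j'].
have {nk} : (k < m)%N \/ k = m /\ ~ upward k th.
  case: (ltngtP k m) => [|mk|/val_inj km]; [by left|by case: nk; left|right].
  by split=> // upk; apply: nk; right; rewrite -km.
(* Each pair is two distinct indices or one index doubled, giving four cases. Distinct indices clash
   on a common triple; a doubled index clashes through [all_up] or [all_down]. *)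
case: kij => [ij|[eij upi]]; case=> [km|[ekm nup]].
- case: (ltngtP i k) => [ik|ki|/val_inj ik].
  + have [tau [mi mk mm]] := mem3 i k m.
    by have := slope_gt0 ik mi mk ri lk; have := slope_lt0 km mk mm lk rm; lra.
  + have [tau [mk mi mj]] := mem3 k i j.
    by have := slope_lt0 ki mk mi lk ri; have := slope_gt0 ij mi mj ri lj; lra.
  + subst k; have [tau [mi mj mm]] := mem3 i j m.
    by have := slope_gt0 ij mi mj ri lj; have := slope_lt0 km mi mm lk rm; lra.
- subst m; case: (ltngtP i k) => [ik|ki|/val_inj ik].
  + apply: nup; apply: (uk i); first by move=> e; move: ik; rewrite e ltnn.
    by move=> tau mk mi; exact: slope_gt0 ik mi mk ri lk.
  + have [tau [mk mi mj]] := mem3 k i j.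
    by have := slope_lt0 ki mk mi lk ri; have := slope_gt0 ij mi mj ri lj; lra.
  + subst k; apply: nup; apply: (uk j).
      by move=> e; move: ij; rewrite e ltnn.
    by move=> tau mi mj; exact: slope_gt0 ij mi mj ri lj.
- subst j; have kii : positive_pair th i i by right.
  case: (ltngtP i k) => [ik|ki|/val_inj ik].
  + have [tau [mi mk mm]] := mem3 i k m.
    by have := slope_gt0 ik mi mk ri lk; have := slope_lt0 km mk mm lk rm; lra.
  + apply: (ui kii k); first by move=> e; move: ki; rewrite e ltnn.
    by move=> tau mi mk; exact: slope_lt0 ki mk mi lk ri.
  + subst k; apply: (ui kii m); first by move=> e; move: km; rewrite e ltnn.
    by move=> tau mi mm; exact: slope_lt0 km mi mm lk rm.
- subst j m; have kii : positive_pair th i i by right.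
  case: (ltngtP i k) => [ik|ki|/val_inj ik]; last by subst k.
  + apply: nup; apply: (uk i); first by move=> e; move: ik; rewrite e ltnn.
    by move=> tau mk mi; exact: slope_gt0 ik mi mk ri lk.
  + apply: (ui kii k); first by move=> e; move: ki; rewrite e ltnn.
    by move=> tau mi mk; exact: slope_lt0 ki mk mi lk ri.
Qed.

Lemma positive_pair_near th s i j : right_of i th s -> left_of j th s ->
  \forall th' \near th, positive_pair th' i j <-> positive_pair th i j.
Proof.
move=> ri lj; case: (eqVneq i j) => [ij|/eqP ij].
  subst j; apply: filterS (upward_near ri lj) => th' H.
  by rewrite /positive_pair H.
by near=> th'; rewrite /positive_pair; split=> -[|[]//]; left.
Unshelve. all: by end_near. Qed.

Lemma positive_pairDpi th s i j : right_of i th s -> left_of j th s ->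
  positive_pair (th + pi) j i <-> ~ positive_pair th i j.
Proof.
move=> ri lj; case: (ltngtP i j) => [ij|ji|/val_inj ij].
- split; last by case; left.
  by case=> [ji|[e]]; [move: (ltn_trans ij ji) | move: ij; rewrite e];
    rewrite ltnn.
- split; last by left.
  move=> _ [ij|[e]]; [move: (ltn_trans ij ji) | move: ji; rewrite e];
  by rewrite ltnn.
- subst j; have H := upwardDpi ri lj; rewrite /positive_pair ltnn.
  split; first by case=> // -[_ /H nu] [|[]].
  by move=> nk; right; split=> //; apply/H => ?; apply: nk; right.
Qed.

(** The offset is quantified away, so that the sign belongs to the direction alone. *)
Definition signed (b : bool) (th : R) := exists s i j,
  [/\ right_of i th s, left_of j th s &
    if b then positive_pair th i j else ~ positive_pair th i j].

Lemma open_signed b : open (signed b).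
Proof.
rewrite openE => th -[s [i [j [ri lj k]]]]; rewrite /interior.
near=> th'; exists s, i, j; split.
- by near: th'; exact: right_of_near.
- by near: th'; exact: left_of_near.
- have : positive_pair th' i j <-> positive_pair th i j.
    by near: th'; exact: positive_pair_near ri lj.
  by case: b k => k H; [apply/H | move/H].
Unshelve. all: by end_near. Qed.

(** Right failures persist at larger offsets and left failures at smaller ones. Hence the right
    failure from the smaller offset and the left failure from the larger one hold at both, and this
    mixed pair carries the sign across. *)
Lemma signed_disjoint th : signed true th -> signed false th -> False.
Proof.
move=> [s [i [j [ri lj k1]]]] [s' [m [k [rm lk k2]]]]; apply: k2.
case: (leP s s') => [ss'|/ltW s's].
- have ki := positive_pair_unique ri lj k1 ri (left_ofW ss' lk).
  exact: (positive_pair_unique (right_ofW ss' ri) lk ki rm lk).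
- have ki := positive_pair_unique ri lj k1 (right_ofW s's rm) lj.
  exact: (positive_pair_unique rm (left_ofW s's lj) ki rm lk).
Qed.

Lemma signedDpi b th : signed b th -> signed (~~ b) (th + pi).
Proof.
move=> [s [i [j [ri lj k]]]]; exists (- s), j, i; split.
- exact/right_ofDpi.
- exact/left_ofDpi.
- have H := positive_pairDpi ri lj.
  by case: b k => k /=; [move/H | apply/H].
Qed.

Lemma ordered_lines_common_cut : exists th s, forall i,
  (exists2 tau, mem i tau & forall t, S i tau t ->
     s <= height th (a tau) + t * height th (u tau)) /\
  (exists2 tau, mem i tau & forall t, S i tau t ->
     height th (a tau) + t * height th (u tau) <= s).
Proof.
apply: contrapT => /forallNP nocut.
have cover th s : (exists i, right_of i th s) \/ (exists i, left_of i th s).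
  apply: contrapT => /not_orP[/forallNP nr /forallNP nl].
  apply: (nocut th); exists s => i; split.
  - have /existsNP[tau /not_implyP[mi H]] := nr i; exists tau => // t St.
    by rewrite leNgt; apply/negP => lt; apply: H; exists t.
  - have /existsNP[tau /not_implyP[mi H]] := nl i; exists tau => // t St.
    by rewrite leNgt; apply/negP => lt; apply: H; exists t.
have total th : signed true th \/ signed false th.
  (* Right failures occur at large offsets, left failures at small ones; both conditions are open
     and together cover all offsets, so some offset has both. *)
  have [s [[i ri] [j lj]]] : exists s, (exists i, right_of i th s) /\
      (exists i, left_of i th s).
    apply: (@open_cover_real_meet R [set s | exists i, right_of i th s]
                                    [set s | exists i, left_of i th s]).
    - rewrite openE => s [i ri]; rewrite /interior.
      by apply: filterS (right_of_near_offset ri) => s' ?; exists i.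
    - rewrite openE => s [i ri]; rewrite /interior.
      by apply: filterS (left_of_near_offset ri) => s' ?; exists i.
    - by have [s rs] := right_of_ex (Ordinal n_gt0) th; exists s, (Ordinal n_gt0).
    - by have [s rs] := left_of_ex (Ordinal n_gt0) th; exists s, (Ordinal n_gt0).
    - exact: cover.
  by case: (pselect (positive_pair th i j)) => k; [left|right]; exists s, i, j.
(* The same connectedness argument for directions: a turn by [pi] shows that both signs occur. *)
have [th [+ +]] : exists th, signed true th /\ signed false th.
  apply: open_cover_real_meet => //; try exact: open_signed.
  - by case: (total 0) => [|/signedDpi]; [exists 0 | exists (0 + pi)].
  - by case: (total 0) => [/signedDpi|]; [exists (0 + pi) | exists 0].
exact: signed_disjoint.
Qed.

End ordered_lines.

(** * Convex sets cut by lines *)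

Lemma convex_subsetP (R : realType) (K : set (plane R)) :
  convex_subset K <-> forall x y (t : R), K x -> K y -> 0 <= t -> t <= 1 ->
    K (t * x.1 + (1 - t) * y.1, t * x.2 + (1 - t) * y.2).
Proof.
split=> [cK x y t Kx Ky t0 t1|cK x y t].
  by have := cK x y (Itv01 t0 t1) (mem_set Kx) (mem_set Ky); rewrite inE.
by rewrite !inE => Kx Ky; exact: (cK x y t%:num Kx Ky).
Qed.

Section cuts.
Context (R : realType).
Implicit Types (l h : dline R) (C : set (plane R)).

Lemma side_dline_pt l h t : side l (dline_pt h t) = side l (dl_base h) +
  t * ((dl_dir l).1 * (dl_dir h).2 - (dl_dir l).2 * (dl_dir h).1).
Proof. by rewrite /side /dline_pt /=; ring. Qed.

Lemma side_conv l (x y : plane R) (t : R) :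
  side l (t * x.1 + (1 - t) * y.1, t * x.2 + (1 - t) * y.2) =
  t * side l x + (1 - t) * side l y.
Proof. by rewrite /side /=; ring. Qed.

(** The parameter on [l] of the orthogonal projection of [x]. *)
Definition dline_coord l (x : plane R) : R :=
  ((x.1 - (dl_base l).1) * (dl_dir l).1 + (x.2 - (dl_base l).2) * (dl_dir l).2)
  / ((dl_dir l).1 ^+ 2 + (dl_dir l).2 ^+ 2).

Lemma dl_dir_sqr_neq0 l : (dl_dir l).1 ^+ 2 + (dl_dir l).2 ^+ 2 != 0.
Proof.
rewrite paddr_eq0 ?sqr_ge0 // !sqrf_eq0; apply/negP => /andP[/eqP h1 /eqP h2].
by apply: (@dl_dir_neq0 _ l); move: h1 h2; case: (dl_dir l) => /= ? ? -> ->.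
Qed.

Lemma dline_ptK l : cancel (dline_pt l) (dline_coord l).
Proof.
move=> t; have d0 := dl_dir_sqr_neq0 l.
by rewrite /dline_coord /dline_pt /=; field.
Qed.

Lemma dline_coordK l x : side l x = 0 -> dline_pt l (dline_coord l x) = x.
Proof.
move=> sx; have d0 := dl_dir_sqr_neq0 l.
rewrite /dline_coord /dline_pt; move: sx d0; rewrite /side.
case: x => x1 x2 /=; case: (dl_base l) => b1 b2; case: (dl_dir l) => d1 d2 /=.
move=> sx d0; congr pair; apply/eqP; rewrite -subr_eq0; apply/eqP.
(* The projection error is a multiple of [side l x], which vanishes. *)
- have -> : b1 + ((x1 - b1) * d1 + (x2 - b2) * d2) / (d1 ^+ 2 + d2 ^+ 2) * d1
     - x1 = d2 * (d1 * (x2 - b2) - d2 * (x1 - b1)) / (d1 ^+ 2 + d2 ^+ 2).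
    by field.
  by rewrite sx mulr0 mul0r.
- have -> : b2 + ((x1 - b1) * d1 + (x2 - b2) * d2) / (d1 ^+ 2 + d2 ^+ 2) * d2
     - x2 = - d1 * (d1 * (x2 - b2) - d2 * (x1 - b1)) / (d1 ^+ 2 + d2 ^+ 2).
    by field.
  by rewrite sx mulr0 mul0r.
Qed.

Lemma side_dline_pt_self l t : side l (dline_pt l t) = 0.
Proof. by rewrite /side /dline_pt /=; ring. Qed.

Lemma continuous_side l : continuous (side l).
Proof.
move=> x; rewrite /side; apply: cvgB; apply: cvgM; try exact: cvg_cst;
  apply: cvgB; try exact: cvg_cst; [exact: cvg_snd | exact: cvg_fst].
Qed.

Lemma continuous_dline_coord l : continuous (dline_coord l).
Proof.
move=> x; rewrite /dline_coord; apply: cvgM; last exact: cvg_cst.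
apply: cvgD; apply: cvgM; try exact: cvg_cst; apply: cvgB; try exact: cvg_cst;
  [exact: cvg_fst | exact: cvg_snd].
Qed.

(** By compactness [A] has a last point on [l] and [B] a first one; [d] is the difference of their
    parameters. *)
Lemma precedes_gap l (A B : set (plane R)) : compact A -> compact B ->
  Defs.meets l A -> Defs.meets l B -> precedes l A B ->
  exists2 d : R, 0 < d &
    forall s t, A (dline_pt l s) -> B (dline_pt l t) -> s + d <= t.
Proof.
move=> cA cB [a Aa] [b Bb] AB.
have cl : closed (side l @^-1` [set 0]).
  apply: closed_comp; last exact: closed_eq.
  by move=> x _; exact: continuous_side.
have [x /set_mem[Ax sx] xmax] := @compact_EVT_max _ R (dline_coord l) _
  (ex_intro _ _ (conj Aa (side_dline_pt_self l a)))
  (compact_closedI cA cl) (continuous_subspaceT (@continuous_dline_coord l)).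
have [y /set_mem[By sy] ymin] := @compact_EVT_min _ R (dline_coord l) _
  (ex_intro _ _ (conj Bb (side_dline_pt_self l b)))
  (compact_closedI cB cl) (continuous_subspaceT (@continuous_dline_coord l)).
exists (dline_coord l y - dline_coord l x).
  by rewrite subr_gt0; apply: AB; rewrite dline_coordK.
move=> s t As Bt.
have /xmax : dline_pt l s \in A `&` side l @^-1` [set 0].
  by rewrite inE; split => //; exact: side_dline_pt_self.
have /ymin : dline_pt l t \in B `&` side l @^-1` [set 0].
  by rewrite inE; split => //; exact: side_dline_pt_self.
rewrite !dline_ptK; lra.
Qed.

Lemma convex_lplus l C : convex_subset C -> convex_subset (lplus l C).
Proof.
move=> /convex_subsetP cC; apply/convex_subsetP => x y t [Cx sx] [Cy sy] t0 t1.
split; first exact: cC.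
by rewrite /= side_conv addr_ge0 // mulr_ge0 // subr_ge0.
Qed.

Lemma rev_dir_neq0 l : (- (dl_dir l).1, - (dl_dir l).2) <> (0, 0).
Proof.
move=> [/eqP + /eqP]; rewrite !oppr_eq0 => /eqP h1 /eqP h2.
by apply: (@dl_dir_neq0 _ l); move: h1 h2; case: (dl_dir l) => /= ? ? -> ->.
Qed.

Definition rev_dline l : dline R := DLine (dl_base l) (@rev_dir_neq0 l).

Lemma side_rev_dline l x : side (rev_dline l) x = - side l x.
Proof. by rewrite /side /=; ring. Qed.

Lemma lplus_rev_dline l C : lplus (rev_dline l) C = lminus l C.
Proof.
by apply/seteqP; split => x [Cx /=] sx; split => //; move: sx;
  rewrite /= side_rev_dline oppr_ge0.
Qed.

Lemma convex_lminus l C : convex_subset C -> convex_subset (lminus l C).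
Proof. by rewrite -lplus_rev_dline; exact: convex_lplus. Qed.

(** A segment joining points on opposite sides would meet [h] inside [C]; [t] is the weight of the
    crossing point. *)
Lemma convex_one_side h C : convex_subset C ->
  (forall x, C x -> side h x != 0) ->
  (forall x, C x -> 0 < side h x) \/ (forall x, C x -> side h x < 0).
Proof.
move=> /convex_subsetP cC nz.
case: (pselect (forall x, C x -> 0 < side h x)) => [|/existsNP[x]]; first by left.
move=> /not_implyP[Cx /negP]; rewrite -leNgt le_eqVlt (negbTE (nz _ Cx)) /= => sx.
right=> y Cy; rewrite ltNge; apply/negP => sy0.
have {sy0} sy : 0 < side h y by rewrite lt_neqAle eq_sym nz.
have d0 : side h y - side h x != 0 by apply/eqP; lra.
pose t := side h y / (side h y - side h x).
have t0 : 0 <= t by rewrite divr_ge0 //; lra.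
have t1 : t <= 1 by rewrite ler_pdivrMr; lra.
have := nz _ (cC x y t Cx Cy t0 t1); rewrite side_conv => /eqP; apply.
by rewrite /t; field.
Qed.

Lemma convex_strict_side l C : convex_subset C ->
  convex_subset (C `&` [set x | 0 < side l x]).
Proof.
move=> /convex_subsetP cC; apply/convex_subsetP => x y t [Cx sx] [Cy sy] t0 t1.
split; first exact: cC.
rewrite /= side_conv; move: t0; rewrite le_eqVlt => /orP[/eqP<-|t0].
  by rewrite mul0r add0r subr0 mul1r.
apply: ltr_pwDl; first exact: mulr_gt0.
by apply: mulr_ge0; [rewrite subr_ge0 | exact: ltW].
Qed.

(** If a point of [lplus l C] were strictly right of [h], the segment from it to [y] would cross [h]
    at a point strictly left of [l]. *)
Lemma lplus_sub_of_strict l h C : convex_subset C ->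
  (exists2 y, C y & 0 < side l y) ->
  (forall x, C x -> 0 < side l x -> 0 < side h x) ->
  lplus l C `<=` lplus h C.
Proof.
move=> /convex_subsetP cC [y Cy ly] H x [Cx /= lx]; split => //=.
rewrite leNgt; apply/negP => hx; have hy := H _ Cy ly.
have d0 : side h y - side h x != 0 by apply/eqP; lra.
pose t := side h y / (side h y - side h x).
have t0 : 0 <= t by rewrite divr_ge0 //; lra.
have t1 : t < 1 by rewrite ltr_pdivrMr; lra.
have := H _ (cC x y t Cx Cy t0 (ltW t1)); rewrite !side_conv.
have -> : t * side h x + (1 - t) * side h y = 0 by rewrite /t; field.
rewrite ltxx => H'; suff /H' : 0 < t * side l x + (1 - t) * side l y by [].
apply: ltr_wpDl; first exact: mulr_ge0.
by apply: mulr_gt0; [rewrite subr_gt0 | ].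
Qed.

(** The first two hypotheses say that [h] and [l] are the same line up to direction. *)
Lemma parallel_side0 l h x :
  (dl_dir l).1 * (dl_dir h).2 - (dl_dir l).2 * (dl_dir h).1 = 0 ->
  side l (dl_base h) = 0 -> side l x = 0 -> side h x = 0.
Proof.
move=> lh lb lx.
have e1 : (dl_dir l).1 * side h x = (dl_dir h).1 * (side l x - side l (dl_base h))
   - (x.1 - (dl_base h).1) *
     ((dl_dir l).1 * (dl_dir h).2 - (dl_dir l).2 * (dl_dir h).1).
  by rewrite /side; ring.
have e2 : (dl_dir l).2 * side h x = (dl_dir h).2 * (side l x - side l (dl_base h))
   - (x.2 - (dl_base h).2) *
     ((dl_dir l).1 * (dl_dir h).2 - (dl_dir l).2 * (dl_dir h).1).
  by rewrite /side; ring.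
move: e1 e2; rewrite lh lb lx subrr !mulr0 subr0 => /eqP + /eqP.
rewrite !mulf_eq0 => /orP[/eqP l1|/eqP->//] /orP[/eqP l2|/eqP->//].
by have := dl_dir_sqr_neq0 l; rewrite l1 l2 expr0n addr0 eqxx.
Qed.

(* If the part of [C] strictly right of [l] misses [hl], it lies on one
   side of [hl], so a half of [C] cut by [hl] lies in [lplus l C]; this settles
   increasing [g].  For decreasing [g], the part of [C] strictly left of [l] is
   contained in a half cut by [hr]; when that part is empty, the slack [e] forces
   [hl] to be parallel to [l], hence equal to it. *)
Lemma cut_lplus_ge (g : set (plane R) -> R) (al e : R) C l hl hr :
  monotone_on_convex g -> convex_subset C -> 0 < e -> Defs.meets hl C ->
  fa_stabber g al C hl -> fa_stabber g al C hr ->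
  (forall s t, C (dline_pt hl s) -> `|t - s| <= e ->
     0 <= side l (dline_pt hl t)) ->
  (forall s, C (dline_pt hr s) -> side l (dline_pt hr s) <= 0) ->
  al <= g (lplus l C).
Proof.
move=> mono cC e0 [t0 Ct0] [sl1 sl2] [sr1 sr2] Hl Hr.
case: mono => mono.
- have nz x : (C `&` [set x | 0 < side (rev_dline l) x]) x -> side hl x != 0.
    move=> [Cx /=]; rewrite side_rev_dline oppr_gt0 => lx; apply/eqP => hx.
    move: (hx) => /dline_coordK hE; move: Cx lx; rewrite -hE => Cx.
    by rewrite ltNge (Hl _ _ Cx) // subrr normr0 ltW.
  have [H|H] := convex_one_side (convex_strict_side (l := rev_dline l) cC) nz.
  + apply: (le_trans sl2); apply: mono;
      [exact: convex_lminus|exact: convex_lplus|].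
    move=> x [Cx /= hx]; split=> //=; rewrite leNgt; apply/negP => lx.
    have := H x; rewrite /= side_rev_dline oppr_gt0 => /(_ (conj Cx lx)).
    by rewrite ltNge hx.
  + apply: (le_trans sl1); apply: mono; [exact: convex_lplus..|].
    move=> x [Cx /= hx]; split=> //=; rewrite leNgt; apply/negP => lx.
    have := H x; rewrite /= side_rev_dline oppr_gt0 => /(_ (conj Cx lx)).
    by rewrite ltNge hx.
- case: (pselect (exists2 y, C y & 0 < side l y)) => [ex|nex].
  + have nz x : (C `&` [set x | 0 < side l x]) x -> side hr x != 0.
      move=> [Cx /= lx]; apply/eqP => hx.
      move: (hx) => /dline_coordK hE; move: Cx lx; rewrite -hE => Cx.
      by rewrite ltNge Hr.
    have [H|H] := convex_one_side (convex_strict_side (l := l) cC) nz.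
    * apply: (le_trans sr1); apply: mono; [exact: convex_lplus..|].
      by apply: lplus_sub_of_strict => // x Cx lx; exact: H.
    * apply: (le_trans sr2); apply: mono;
        [exact: convex_lplus|exact: convex_lminus|].
      rewrite -lplus_rev_dline; apply: lplus_sub_of_strict => // x Cx lx.
      by rewrite side_rev_dline oppr_gt0; exact: H.
  + have Cle x : C x -> side l x <= 0.
      by move=> Cx; rewrite leNgt; apply/negP => lx; apply: nex; exists x.
    have tt0 : side l (dline_pt hl t0) = 0.
      apply/eqP; rewrite eq_le Cle //=; apply: (Hl t0) => //.
      by rewrite subrr normr0 ltW.
    have tp : 0 <= side l (dline_pt hl (t0 + e)).
      by apply: (Hl t0) => //; rewrite addrAC subrr add0r gtr0_norm.
    have tm : 0 <= side l (dline_pt hl (t0 - e)).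
      by apply: (Hl t0) => //; rewrite addrAC subrr add0r normrN gtr0_norm.
    move: tt0 tp tm; rewrite !side_dline_pt.
    set c := (_ - _ * _); set b := side l _ => tt0 tp tm.
    have c0 : c = 0 by nra.
    have b0 : b = 0 by move: tt0; rewrite c0 mulr0 addr0.
    apply: (le_trans sl1); apply: mono; [exact: convex_lplus..|].
    move=> x [Cx /= lx]; split=> //=.
    have -> // : side hl x = 0.
    by apply: (parallel_side0 c0 b0); apply/eqP; rewrite eq_le lx Cle.
Qed.

(** The second half is the first one for the reversed line, with [hl] and [hr] exchanged. *)
Lemma cut_stabber (g : set (plane R) -> R) (al e e' : R) C l hl hr :
  monotone_on_convex g -> convex_subset C -> 0 < e -> 0 < e' ->
  Defs.meets hl C -> Defs.meets hr C ->
  fa_stabber g al C hl -> fa_stabber g al C hr ->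
  (forall s t, C (dline_pt hl s) -> `|t - s| <= e ->
     0 <= side l (dline_pt hl t)) ->
  (forall s t, C (dline_pt hr s) -> `|t - s| <= e' ->
     side l (dline_pt hr t) <= 0) ->
  fa_stabber g al C l.
Proof.
move=> mono cC e0 e'0 ml mr sl sr Hl Hr; split.
  apply: (cut_lplus_ge mono cC e0 ml sl sr) => // s Cs.
  by apply: (Hr s) => //; rewrite subrr normr0 ltW.
rewrite -lplus_rev_dline; apply: (cut_lplus_ge mono cC e'0 mr sr sl).
- by move=> s t Cs st; rewrite side_rev_dline oppr_ge0; exact: Hr Cs st.
- move=> s Cs; rewrite side_rev_dline oppr_le0; apply: (Hl s) => //.
  by rewrite subrr normr0 ltW.
Qed.

End cuts.

(** * Index triples, choice of transversals, and the common line *)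

Lemma ord_triple_cover n (i j k : 'I_n) : (3 <= n)%N ->
  exists p q r : 'I_n,
    [/\ (p < q)%N, (q < r)%N & {subset [:: i; j; k] <= [:: p; q; r]}].
Proof.
move=> n3; pose t := undup [:: i; j; k].
(* All indices, with the distinct ones among [i, j, k] first: the first three entries contain these
   even if some coincide, and sorting them gives [p, q, r]. *)
pose u := t ++ [seq x <- enum 'I_n | x \notin t].
have uu : uniq u.
  rewrite cat_uniq undup_uniq filter_uniq ?enum_uniq // andbT /=.
  by apply/hasPn => x; rewrite mem_filter => /andP[].
have su : size u = n.
  rewrite -[RHS](size_enum_ord n); apply/esym/eqP.
  rewrite -(uniq_size_uniq uu) ?enum_uniq // => x.
  by rewrite mem_enum mem_cat mem_filter mem_enum andbT orbN.
pose v := sort (relpre val leq) (take 3 u).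
have sv : size v = 3 by rewrite size_sort size_takel // su.
have uv : sorted (relpre val ltn) v.
  rewrite -sorted_map ltn_sorted_uniq_leq.
  rewrite (map_inj_uniq val_inj) sort_uniq take_uniq //= sorted_map.
  by apply: sort_sorted => x y; exact: leq_total.
have tv : {subset [:: i; j; k] <= v}.
  move=> x xs; rewrite mem_sort take_cat.
  have st : (size t <= 3)%N := size_undup [:: i; j; k].
  case: ltnP => h; first by move: (leq_trans h st); rewrite ltnn.
  by rewrite mem_cat mem_undup xs.
case: v sv uv tv => [|p [|q [|r []]]] //= _ /and3P[pq qr _] tv.
by exists p, q, r.
Qed.

Theorem theorem1p1 (R : realType) (n : nat) (hn : (3 <= n)%N)
    (C : 'I_n -> set (plane R))
    (Ccompact : forall i, compact (C i))
    (Cconvex : forall i, convex_subset (C i))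
    (Cdisjoint : trivIset [set: 'I_n] C)
    (f : 'I_n -> set (plane R) -> R)
    (fmono : forall i, monotone_on_convex (f i))
    (fcont : forall i, hausdorff_continuous (f i))
    (alpha : 'I_n -> R)
    (alpha_gt0 : forall i, 0 < alpha i)
    (htriple : forall i j k : 'I_n, (i < j)%N -> (j < k)%N ->
       exists l : dline R,
         fa_transversal C f alpha [set i; j; k] l /\
         meets_in_order l (C i) (C j) (C k)) :
  exists l : dline R, fa_transversal C f alpha [set: 'I_n] l.
Proof.
pose valid (tau : 'I_n * 'I_n * 'I_n) :=
  (tau.1.1 < tau.1.2)%N && (tau.1.2 < tau.2)%N.
pose mem i (tau : 'I_n * 'I_n * 'I_n) :=
  valid tau && (i \in [:: tau.1.1; tau.1.2; tau.2]).
(* [F] picks for each increasing triple a transversal and a slack by which its traces can be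
   enlarged without losing their order. Other triples get a dummy line. *)
have /choice[F HF] : forall tau, exists le : dline R * R, valid tau ->
    [/\ 0 < le.2, forall i, mem i tau ->
          fa_stabber (f i) (alpha i) (C i) le.1 /\ Defs.meets le.1 (C i)
      & forall i j, mem i tau -> mem j tau -> (i < j)%N ->
          forall s t, C i (dline_pt le.1 s) -> C j (dline_pt le.1 t) ->
          s + le.2 < t - le.2].
  case=> -[p q] r; case: (boolP (valid (p, q, r))) => [v|]; last first.
    have d0 : ((1, 0) : plane R) <> (0, 0) by move=> -[/eqP]; rewrite oner_eq0.
    by exists (DLine (0, 0) d0, 0).
  move: (v) => /andP[/= pq qr].
  have [l [tr [mp mq mr lpq lqr]]] := htriple _ _ _ pq qr.
  have [d1 d10 D1] := precedes_gap (Ccompact p) (Ccompact q) mp mq lpq.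
  have [d2 d20 D2] := precedes_gap (Ccompact q) (Ccompact r) mq mr lqr.
  have [m1 m2] : Num.min d1 d2 <= d1 /\ Num.min d1 d2 <= d2.
    by rewrite !ge_min !lexx orbT.
  have m0 : 0 < Num.min d1 d2 by rewrite lt_min d10.
  (* Two slacks of a third of the smaller gap leave a strict inequality. *)
  exists (l, Num.min d1 d2 / 3%:R) => _ /=; set m := Num.min d1 d2 in m0 m1 m2 *.
  split; first by rewrite divr_gt0.
    move=> i; rewrite /mem v /= !inE => /or3P[] /eqP->; split=> //; apply: tr.
    - by left; left.
    - by left; right.
    - by right.
  have [b Cb] := mq.
  have strict (x y : 'I_n) : (x < y)%N -> (y < x)%N -> False.
    by move=> /ltn_trans h /h; rewrite ltnn.
  move=> i j; rewrite /mem v /= !inE.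
  move=> /or3P[] /eqP-> /or3P[] /eqP->; rewrite ?ltnn //= => xy s t Cs Ct;
    try by case: (strict _ _ xy).
  - by have := D1 _ _ Cs Ct; lra.
  (* The first and third sets are compared through a point of the middle one. *)
  - by have := D1 _ _ Cs Cb; have := D2 _ _ Cb Ct; lra.
  - by have := D2 _ _ Cs Ct; lra.
  - by case: (strict _ _ (ltn_trans pq qr) xy).
(* The traces are thickened by the slack to provide the intervals around trace points that
   [cut_stabber] asks for. *)
pose S i tau := [set t | exists2 s, C i (dline_pt (F tau).1 s) &
                                    `|t - s| <= (F tau).2].
have memv i tau : mem i tau -> valid tau by case/andP.
have [th [s cut]] : exists th s, forall i,
  (exists2 tau, mem i tau & forall t, S i tau t -> s <=
     height th (dl_base (F tau).1) + t * height th (dl_dir (F tau).1)) /\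
  (exists2 tau, mem i tau & forall t, S i tau t ->
     height th (dl_base (F tau).1) + t * height th (dl_dir (F tau).1) <= s).
  apply: (@ordered_lines_common_cut R n _ mem
    (fun tau => dl_base (F tau).1) (fun tau => dl_dir (F tau).1) S).
  - exact: leq_trans hn.
  - move=> i j k; have [p [q [r [pq qr sub]]]] := ord_triple_cover i j k hn.
    by exists (p, q, r); rewrite /mem /valid /= pq qr; split; apply: sub;
      rewrite !inE eqxx ?orbT.
  - move=> i tau mi; have [e0 /(_ i mi)[_ [t Ct]] _] := HF _ (memv _ _ mi).
    by exists t; exists t => //; rewrite subrr normr0 ltW.
  - move=> i j tau mi mj ij s t [s' Cs ss'] [t' Ct tt'].
    have [_ _ /(_ i j mi mj ij _ _ Cs Ct)] := HF _ (memv _ _ mi).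
    by move: ss' tt'; rewrite !ler_norml => /andP[_ ?] /andP[? _]; lra.
have d0 : (cos th, sin th) <> (0, 0).
  move=> [c0 s0]; have := cos2Dsin2 th.
  by rewrite c0 s0 expr0n addr0 => /eqP; rewrite eq_sym oner_eq0.
(* The line of direction [(cos th, sin th)] whose points have height [s], based at the foot of the
   perpendicular from the origin. *)
exists (DLine (- s * sin th, s * cos th) d0) => i _.
have sideE h t : side (DLine (- s * sin th, s * cos th) d0) (dline_pt h t) =
    height th (dl_base h) + t * height th (dl_dir h) - s.
  by rewrite -[in RHS](mulr1 s) -(cos2Dsin2 th) /side /dline_pt /height /=; ring.
have [[tl ml Hl] [tr mr Hr]] := cut i.
have [el0 /(_ i ml)[sl mel] _] := HF _ (memv _ _ ml).
have [er0 /(_ i mr)[sr mer] _] := HF _ (memv _ _ mr).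
apply: (cut_stabber (fmono i) (Cconvex i) el0 er0 mel mer sl sr).
- by move=> x t Cx xt; rewrite sideE subr_ge0; apply: Hl; exists x.
- by move=> x t Cx xt; rewrite sideE subr_le0; apply: Hr; exists x.
Qed.
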